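(* Let $\alpha,\beta$ be real numbers with $\alpha>0$, $\beta>\frac12$ and $\alpha+\beta<1$. Suppose that for every integer $j\geq 0$, \[ \bigl(\alpha+(1-\alpha)\alpha^{j+1}\bigr)\bigl(\beta-\beta(1-\beta)^{j+1}\bigr)<\alpha\beta, \] i.e. $\mu_\alpha(\mathcal{A}_j)\mu_\beta(\mathcal{B}_j)<\alpha\beta$ for all $j\ge 0$ (families defined in the context). Then for every $n\geq 1$, \[ \max\{\mu_\alpha(\mathcal{F})\mu_\beta(\mathcal{G}) : \mathcal{F},\mathcal{G}\subset 2^{[n]} \text{ cross-intersecting}\}=\alpha\beta . \]
   Context: $[n]=\{1,\dots,n\}$ and $2^{[n]}$ is its power set. For $p\in(0,1)$ and $\mathcal{F}\subset 2^{[n]}$, $\mu_p(\mathcal{F}):=\sum_{F\in\mathcal{F}}p^{|F|}(1-p)^{n-|F|}$. Two families $\mathcal{F},\mathcal{G}$ are cross-intersecting if $F\cap G\neq\emptyset$ for all $F\in\mathcal{F}$, $G\in\mathcal{G}$. For $j\ge 0$ and $n\ge j+2$, $\mathcal{A}_j:=\{A\in 2^{[n]}:1\in A\}\sqcup\{A\in 2^{[n]}:A\cap[j+2]=[j+2]\setminus\{1\}\}$ and $\mathcal{B}_j:=\{B\in 2^{[n]}:1\in B\}\setminus\{B\in 2^{[n]}:B\cap[j+2]=\{1\}\}$; these are cross-intersecting and $\mu_\alpha(\mathcal{A}_j)=\alpha+(1-\alpha)\alpha^{j+1}$, $\mu_\beta(\mathcal{B}_j)=\beta-\beta(1-\beta)^{j+1}$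 (independent of $n$). *)

(* Defs.v *)
From mathcomp Require Import all_boot all_order all_algebra.
From mathcomp Require Import classical_sets reals.

Set Implicit Arguments.
Unset Strict Implicit.
Unset Printing Implicit Defensive.

Import Order.TTheory GRing.Theory Num.Theory.
Local Open Scope ring_scope.

(* The ground set [n] = {1, ..., n} is encoded as 'I_n = {0, ..., n-1}. *)

Definition mu (R : realType) (n : nat) (p : R) (F : {set {set 'I_n}}) : R :=
  \sum_(A in F) p ^+ #|A| * (1 - p) ^+ (n - #|A|).

Definition cross_intersecting (n : nat) (F G : {set {set 'I_n}}) : Prop :=
  forall A B : {set 'I_n}, A \in F -> B \in G -> A :&: B != finset.set0.

Definition is_max (R : realType) (S : set R) (m : R) : Prop :=
  S m /\ ubound S m.

(* Main.v *)
(* Put a = alpha and q = 1 - beta. If F and G are cross-intersecting and U is the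
   up-closure of F, the complements of the members of G avoid U, so it suffices
   to bound mu_a(U) * (1 - mu_q(U)) for an up-set U. As in the Kruskal-Katona
   theorem, for a given mu_a(U) the measure mu_q(U) is smallest for lexicographic
   initial segments, whose profile L satisfies L (a t) = q L t and
   L (a + (1 - a) t) = q + (1 - q) L t. Hence L (mu_a U) <= mu_q U follows by
   induction on the number of coordinates from the two-point inequality
   L ((1 - a) x + a y) <= (1 - q) L x + q L y for x <= y, which is proved together
   with four companion inequalities stable under the self-similarity of L.
   Instead of L we use its approximations from below, obtained by iterating the
   self-similarity from the map multiplying odds by odds(q) / odds(a). The points
   a + (1 - a) a^(j+1), the measures of the families A_j, cut [a, 1] into pieces
   on each of which such an approximation of L stays above the hyperbola
   x (1 - y) = a (1 - q) as soon as it does so at the end points. *)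

Require Import Defs.
From mathcomp Require Import classical_sets reals.
From mathcomp Require Import all_boot all_order all_algebra.
From mathcomp Require Import ring lra.

Set Implicit Arguments.
Unset Strict Implicit.
Unset Printing Implicit Defensive.

Import Order.TTheory GRing.Theory Num.Theory.
Local Open Scope ring_scope.

(** * The self-similar lexicographic profile *)

Section LexProfile.
Variables (R : realFieldType) (a q : R).
Hypotheses (a_gt0 : 0 < a) (lt_aq : a < q) (q_lt : 2 * q < 1).

Let a1_gt0 : 0 < 1 - a.
Proof. by move: a_gt0 lt_aq q_lt; lra. Qed.
Let q_gt0 : 0 < q.
Proof. by move: a_gt0 lt_aq q_lt; lra. Qed.
Let q1_gt0 : 0 < 1 - q.
Proof. by move: a_gt0 lt_aq q_lt; lra. Qed.

(** A lexicographic initial segment of measure at most [a] lies inside the star of the first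
    coordinate; a larger one contains that star and continues with a segment of the remaining sets.
    The star has measure [a] for one bias and [q] for the other. *)
Definition lex_step (f : R -> R) (x : R) : R :=
  if x <= a then q * f (x / a) else q + (1 - q) * f ((x - a) / (1 - a)).

(* [lex_sub] and [lex_sup] are subadditivity of [f] and superadditivity of its
   dual [x |-> 1 - f (1 - x)]; [lex_odds] and [lex_odds_dual] say that scaling
   the argument by the odds [a / (1 - a)] scales [f] and its dual by at most
   [q / (1 - q)]. *)
Record lex_profile (f : R -> R) : Prop := LexProfile {
  lex_0 : f 0 = 0;
  lex_1 : f 1 = 1;
  lex_sub : forall x y, 0 <= x -> 0 <= y -> x + y <= 1 -> f (x + y) <= f x + f y;
  lex_sup : forall x y, x <= 1 -> y <= 1 -> 1 <= x + y ->
    1 + f (x + y - 1) <= f x + f y;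
  lex_odds : forall u v, 0 <= u -> u <= 1 -> (1 - a) * v = a * u ->
    (1 - q) * f v <= q * f u;
  lex_odds_dual : forall u v, 0 <= u -> u <= 1 -> (1 - a) * v = a * u ->
    (1 - q) * (1 - f (1 - v)) <= q * (1 - f (1 - u)) }.

Lemma lex_stepl f x t : t <= 1 -> x = a * t -> lex_step f x = q * f t.
Proof.
move: (a_gt0) (lt_aq) (q_lt) => a0 aq q2.
move=> t1 ->; rewrite /lex_step ifT.
  by congr (_ * f _); field; apply: lt0r_neq0.
by rewrite -[leRHS]mulr1 ler_pM2l.
Qed.

Lemma lex_stepr f x t : f 0 = 0 -> f 1 = 1 -> 0 <= t -> x = a + (1 - a) * t ->
  lex_step f x = q + (1 - q) * f t.
Proof.
move: (a_gt0) (lt_aq) (q_lt) => a0 aq q2.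
(* At [t = 0] the definition takes its left branch; [f 0 = 0] and [f 1 = 1] make both branches equal
   to [q] there. *)
move=> f0 f1 t0 ->; move: t0; rewrite le_eqVlt => /predU1P[<-|t0].
  by rewrite (@lex_stepl _ _ 1) ?f0 ?f1 //; ring.
rewrite /lex_step ifF; first by congr (_ + _ * f _); field; apply: lt0r_neq0.
by apply/negP => h; have := mulr_gt0 a1_gt0 t0; lra.
Qed.

Lemma lex_cases x : 0 <= x -> x <= 1 ->
  (exists t, [/\ 0 <= t, t <= 1 & x = a * t]) \/
  (exists t, [/\ 0 <= t, t <= 1 & x = a + (1 - a) * t]).
Proof.
move: (a_gt0) (lt_aq) (q_lt) => a0 aq q2.
move=> x0 x1; have [xa|ax] := leP x a; [left|right].
  exists (x / a); split; rewrite ?divr_ge0 ?ler_pdivrMr ?mul1r //; first by lra.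
  by field; apply: lt0r_neq0.
exists ((x - a) / (1 - a)); split.
- by rewrite divr_ge0; lra.
- by rewrite ler_pdivrMr //; lra.
- by field; apply: lt0r_neq0.
Qed.

Lemma lex_step_le f g : (forall x, 0 <= x -> x <= 1 -> f x <= g x) ->
  f 0 = 0 -> f 1 = 1 -> g 0 = 0 -> g 1 = 1 ->
  forall x, 0 <= x -> x <= 1 -> lex_step f x <= lex_step g x.
Proof.
move: (a_gt0) (lt_aq) (q_lt) => a0 aq q2.
move=> fg f0 f1 g0 g1 x x0 x1.
case: (lex_cases x0 x1) => [[t [t0 t1 e]]|[t [t0 t1 e]]].
  by rewrite !(lex_stepl _ t1 e) ler_pM2l // fg.
by rewrite (lex_stepr f0 f1 t0 e) (lex_stepr g0 g1 t0 e) lerD2l ler_pM2l // fg.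
Qed.

Let ex_div b c : 0 < b -> exists v : R, b * v = c.
Proof. by move=> b0; exists (c / b); field; lra. Qed.

Let le_of_mul (b x y : R) : 0 < b -> b * x <= b * y -> x <= y.
Proof. by move=> b0; rewrite ler_pM2l. Qed.

(** * Stability of the inequalities under one self-similarity step *)

Section Step.
Variable f : R -> R.
Hypothesis lf : lex_profile f.
Hypothesis f_le_step : forall x, 0 <= x -> x <= 1 -> f x <= lex_step f x.
Let f0 := lex_0 lf.
Let f1 := lex_1 lf.
Let g := lex_step f.
Let gl x t : t <= 1 -> x = a * t -> g x = q * f t := @lex_stepl f x t.
Let gr x t : 0 <= t -> x = a + (1 - a) * t -> g x = q + (1 - q) * f t :=
  @lex_stepr f x t f0 f1.

(** Cut both arguments at [a]. When pieces of different scale meet, [w] expresses a length of scale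
    [a] in scale [1 - a], and [lex_odds] pays for the change. *)
Lemma lex_step_sub x y : 0 <= x -> 0 <= y -> x + y <= 1 -> g (x + y) <= g x + g y.
Proof.
move: (a_gt0) (lt_aq) (q_lt) => a0 aq q2.
wlog: x y / (exists t, [/\ 0 <= t, t <= 1 & x = a * t]) \/
    (exists s t, [/\ 0 <= s, 0 <= t, x = a + (1 - a) * s & y = a + (1 - a) * t]).
  move=> W x0 y0 xy1.
  have [x1 y1] : x <= 1 /\ y <= 1 by lra.
  case: (lex_cases x0 x1) => [Lx|[s [s0 s1 es]]]; first by apply: W => //; left.
  case: (lex_cases y0 y1) => [Ly|[t [t0 t1 et]]].
    by rewrite addrC [leRHS]addrC; apply: W => //; [left|rewrite addrC].
  by apply: W => //; right; exists s, t.
case=> [[s [s0 s1 ->]]|[s [t [s0 t0 -> ->]]]] _; last first.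
  move=> _ xy1.
  have [w ew] := ex_div a a1_gt0.
  have w0 : 0 <= w by apply: (le_of_mul a1_gt0); lra.
  have b : w + (s + t) <= 1 by apply: (le_of_mul a1_gt0); lra.
  have b' := lex_sub lf s0 t0; have b2 := lex_sub lf w0 (addr_ge0 s0 t0) b.
  have b3 : (1 - q) * f w <= q * f 1 by apply: lex_odds => //; lra.
  rewrite (gr s0 erefl) (gr t0 erefl) (@gr _ (w + (s + t))); [|lra|lra].
  have b4 : f (w + (s + t)) <= f w + (f s + f t).
    by apply: le_trans b2 _; rewrite lerD2l b' //; lra.
  have := ler_wpM2l (ltW q1_gt0) b4; rewrite f1 in b3; lra.
move=> y0 xy1; have y1 : y <= 1 by have := mulr_ge0 (ltW a_gt0) s0; lra.
case: (lex_cases y0 y1) => -[t [t0 t1 et]]; move: xy1; rewrite et => xy1.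
  rewrite (gl s1 erefl) (gl t1 erefl); have [st|st] := leP (s + t) 1.
    rewrite (@gl _ (s + t)) //; last by ring.
    have := ler_wpM2l (ltW q_gt0) (lex_sub lf s0 t0 st); lra.
  (* The sum overflows the left piece by [a * (s + t - 1)]; superadditivity of the dual controls
     this excess. *)
  have [w ew] := ex_div (a * (s + t - 1)) a1_gt0.
  have w0 : 0 <= w.
    by apply: (le_of_mul a1_gt0); rewrite ew mulr0 mulr_ge0; lra.
  rewrite (@gr _ w) //; last by lra.
  have h : (1 - q) * f w <= q * f (s + t - 1) by apply: lex_odds => //; lra.
  have := ler_wpM2l (ltW q_gt0) (lex_sup lf s1 t1 (ltW st)); lra.
have [w ew] := ex_div (a * s) a1_gt0.
have w0 : 0 <= w by apply: (le_of_mul a1_gt0); rewrite ew mulr0 mulr_ge0; lra.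
have wt1 : w + t <= 1 by apply: (le_of_mul a1_gt0); lra.
rewrite (gl s1 erefl) (gr t0 erefl) (@gr _ (w + t)); [|lra|lra].
have h := lex_odds lf s0 s1 ew.
have := ler_wpM2l (ltW q1_gt0) (lex_sub lf w0 t0 wt1); lra.
Qed.

Lemma lex_step_sup x y : x <= 1 -> y <= 1 -> 1 <= x + y ->
  1 + g (x + y - 1) <= g x + g y.
Proof.
move: (a_gt0) (lt_aq) (q_lt) => a0 aq q2.
(* As [2 * a < 1], two points of sum at least 1 cannot both lie in the left piece. *)
wlog: x y / (exists t, [/\ 0 <= t, t <= 1 & y = a + (1 - a) * t]).
  move=> W x1 y1 xy1.
  have [x0 y0] : 0 <= x /\ 0 <= y by lra.
  case: (lex_cases x0 x1) => [[s [s0 s1 es]]|Rx].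
    case: (lex_cases y0 y1) => [[t [t0 t1 et]]|Ry]; last exact: W.
    have := ler_wpM2l (ltW a_gt0) s1; have := ler_wpM2l (ltW a_gt0) t1; lra.
  by rewrite addrC (addrC x) addrC [leRHS]addrC; apply: W => //; rewrite addrC.
move=> [t [t0 t1 et]] x1 y1 xy1.
have x0 : 0 <= x by lra.
rewrite et in xy1 *; rewrite (gr t0 erefl).
case: (lex_cases x0 x1) => -[s [s0 s1 es]]; move: xy1; rewrite es => xy1.
  have [e ee] := ex_div ((1 - a) * (1 - t)) a_gt0.
  have e0 : 0 <= e.
    by apply: (le_of_mul a_gt0); rewrite ee mulr0 mulr_ge0; lra.
  have es' : e <= s by apply: (le_of_mul a_gt0); rewrite ee; lra.
  rewrite (gl s1 erefl) (@gl _ (s - e)); [|lra|lra].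
  have h : (1 - q) * (1 - f (1 - (1 - t))) <= q * (1 - f (1 - e)).
    by apply: lex_odds_dual => //; lra.
  have k : 1 + f (s + (1 - e) - 1) <= f s + f (1 - e).
    by apply: lex_sup => //; lra.
  rewrite (_ : 1 - (1 - t) = t) in h; last by ring.
  rewrite (_ : s + (1 - e) - 1 = s - e) in k; last by ring.
  have := ler_wpM2l (ltW q_gt0) k; lra.
rewrite (gr s0 erefl); have [st|st] := leP 1 (s + t).
  rewrite (@gr _ (s + t - 1)); [|lra|lra].
  have := ler_wpM2l (ltW q1_gt0) (lex_sup lf s1 t1 st); lra.
have [u eu] := ex_div ((1 - a) * (1 - (s + t))) a_gt0.
have u0 : 0 <= u.
  by apply: (le_of_mul a_gt0); rewrite eu mulr0 mulr_ge0; lra.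
have u1 : u <= 1 by apply: (le_of_mul a_gt0); rewrite eu; lra.
rewrite (@gl _ (1 - u)); [|lra|lra].
have h : (1 - q) * (1 - f (1 - (1 - (s + t)))) <= q * (1 - f (1 - u)).
  by apply: lex_odds_dual => //; lra.
rewrite (_ : 1 - (1 - (s + t)) = s + t) in h; last by ring.
have := ler_wpM2l (ltW q1_gt0) (lex_sub lf s0 t0 (ltW st)); lra.
Qed.

(** Apply [lex_step_sup] to [1 - (1 - a) * u] and [1 - a * u]: they lie in the right piece over
    [1 - u] and [1 - v], and [f_le_step] turns the values of [f] there into values of [g]. *)
Lemma lex_step_odds_dual u v : 0 <= u -> u <= 1 -> (1 - a) * v = a * u ->
  (1 - q) * (1 - g (1 - v)) <= q * (1 - g (1 - u)).
Proof.
move: (a_gt0) (lt_aq) (q_lt) => a0 aq q2.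
move=> u0 u1 e.
have au0 := mulr_ge0 (ltW a_gt0) u0; have bu0 := mulr_ge0 (ltW a1_gt0) u0.
have v0 : 0 <= v by apply: (le_of_mul a1_gt0); rewrite e mulr0.
have v1 : v <= 1.
  apply: (le_of_mul a1_gt0); rewrite e mulr1.
  have := ler_wpM2l (ltW a_gt0) u1; lra.
have : 1 + g ((1 - (1 - a) * u) + (1 - a * u) - 1) <=
       g (1 - (1 - a) * u) + g (1 - a * u).
  by apply: lex_step_sup; lra.
rewrite (_ : (1 - (1 - a) * u) + (1 - a * u) - 1 = 1 - u); last by ring.
rewrite (@gr (1 - (1 - a) * u) (1 - u)); [|lra|ring].
rewrite (@gr (1 - a * u) (1 - v)); [|lra|lra].
have [u0' u1'] : 0 <= 1 - u /\ 1 - u <= 1 by lra.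
have [v0' v1'] : 0 <= 1 - v /\ 1 - v <= 1 by lra.
have := ler_wpM2l (ltW q1_gt0) (f_le_step u0' u1').
have := ler_wpM2l (ltW q1_gt0) (f_le_step v0' v1').
rewrite -/g; lra.
Qed.

(** For [u <= 1 - a], write [u = (1 - a) * w]; then [v = a * w] and [u + v = w], so subadditivity of
    [g] gives the claim. For larger [u] both points lie in the right piece and the inequalities for
    [f] are chained. *)
Lemma lex_step_odds u v : 0 <= u -> u <= 1 -> (1 - a) * v = a * u ->
  (1 - q) * g v <= q * g u.
Proof.
move: (a_gt0) (lt_aq) (q_lt) => a0 aq q2.
move=> u0 u1 e; have [ua|ua] := leP u (1 - a).
  have [w ew] := ex_div u a1_gt0.
  have w0 : 0 <= w by apply: (le_of_mul a1_gt0); rewrite ew mulr0.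
  have w1 : w <= 1 by apply: (le_of_mul a1_gt0); rewrite ew mulr1.
  have ev : v = a * w.
    by apply: (mulfI (lt0r_neq0 a1_gt0)); rewrite e -ew; ring.
  have v0 : 0 <= v by rewrite ev mulr_ge0 // ltW.
  have s : g (u + v) <= g u + g v.
    by apply: lex_step_sub; rewrite // -ew ev; lra.
  rewrite (_ : u + v = w) in s; last by rewrite -ew ev; ring.
  have fw := f_le_step w0 w1; rewrite -/g in fw.
  rewrite (gl w1 ev) in s *.
  have h1 := ler_wpM2l (ltW q_gt0) fw; have h2 := ler_wpM2l (ltW q1_gt0) h1.
  have : q * ((1 - q) * g w) <= q * g u by rewrite ler_pM2l //; lra.
  lra.
have [t et] := ex_div (u - (1 - a)) a_gt0.
have t0 : 0 <= t by apply: (le_of_mul a_gt0); rewrite et; lra.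
have t1 : t <= 1 by apply: (le_of_mul a_gt0); rewrite et; lra.
have at1 : a * t <= a * 1 by rewrite ler_pM2l.
have at0 : 0 <= a * t by apply: mulr_ge0 => //; apply: ltW.
have [z' ez'] := ex_div (a * t) a1_gt0.
have z'0 : 0 <= z' by apply: (le_of_mul a1_gt0); rewrite ez'; lra.
have z'1 : z' <= 1 by apply: (le_of_mul a1_gt0); rewrite ez'; lra.
have [z ez] := ex_div (a * z') a1_gt0.
have z0 : 0 <= z.
  by apply: (le_of_mul a1_gt0); rewrite ez mulr0 mulr_ge0 // ltW.
have ev : v = a + (1 - a) * z.
  apply: (mulfI (lt0r_neq0 a1_gt0)).
  rewrite e mulrDr ez mulrCA ez' et; ring.
have [y ey] := ex_div (u - a) a1_gt0.
have y0 : 0 <= y by apply: (le_of_mul a1_gt0); rewrite ey; lra.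
rewrite (gr z0 ev) (@gr u y) //; last by lra.
(* Two odds scalings lead from [t] to [z], and a dual one links [1 - t] to [1 - y]; the weighted sum
   eliminates [f t]. *)
have h1 := lex_odds lf z'0 z'1 ez; have h2 := lex_odds lf t0 t1 ez'.
have h3 : (1 - q) * (1 - f (1 - (1 - y))) <= q * (1 - f (1 - (1 - t))).
  by apply: lex_odds_dual => //; lra.
rewrite (_ : 1 - (1 - y) = y) in h3; last by ring.
rewrite (_ : 1 - (1 - t) = t) in h3; last by ring.
have := ler_wpM2l (ltW q_gt0) h3; have := ler_wpM2l (ltW q_gt0) h2.
have := ler_wpM2l (ltW q1_gt0) h1; lra.
Qed.

Lemma lex_profile_step : lex_profile g.
Proof.
move: (a_gt0) (lt_aq) (q_lt) => a0 aq q2.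
split; [| |exact: lex_step_sub|exact: lex_step_sup|exact: lex_step_odds
       |exact: lex_step_odds_dual].
- by rewrite (@gl _ 0) ?f0 //; ring.
- by rewrite (@gr _ 1) ?f1 //; ring.
Qed.

(** The inductive step over one coordinate: [x] and [y] stand for the measures of the two sections
    of an up-set, ordered by monotonicity. *)
Definition two_point (k : R -> R) := forall x y, 0 <= x -> x <= y -> y <= 1 ->
  k ((1 - a) * x + a * y) <= (1 - q) * k x + q * k y.

Lemma two_point_step : two_point f -> two_point g.
Proof.
move: (a_gt0) (lt_aq) (q_lt) => a0 aq q2.
move=> tf x y x0 xy y1.
have [x1 y0] : x <= 1 /\ 0 <= y by lra.
case: (lex_cases x0 x1) => -[s [s0 s1 es]];
  case: (lex_cases y0 y1) => -[t [t0 t1 et]]; last first.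
- have st : s <= t by apply: (le_of_mul a1_gt0); lra.
  have m0 : 0 <= (1 - a) * s + a * t by rewrite addr_ge0 ?mulr_ge0 // ltW.
  rewrite (gr s0 es) (gr t0 et) (@gr _ ((1 - a) * s + a * t)) //; last first.
    by rewrite es et; ring.
  have := ler_wpM2l (ltW q1_gt0) (tf _ _ s0 st t1); lra.
(* With [x] in the right piece and [y] in the left one, [x <= y] forces both to be [a]. *)
- have t1' : a * t <= a * 1 by rewrite ler_pM2l.
  have s0' := mulr_ge0 (ltW a1_gt0) s0.
  have -> : (1 - a) * x + a * y = a by rewrite (_ : y = x); lra.
  have s00 : s = 0 by apply: (mulfI (lt0r_neq0 a1_gt0)); lra.
  have t11 : t = 1 by apply: (mulfI (lt0r_neq0 a_gt0)); lra.
  rewrite (gr s0 es) (gl t1 et) (@gl a 1) ?mulr1 // s00 t11 f0 f1; lra.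
(* The mean is [a * (a + (1 - a) * (s + t))], that is [a + (1 - a) * (a * (s + t - 1))]. In either
   form [f_le_step] allows a second unfolding, which leaves [lex_sub] or [lex_sup]. *)
- rewrite (gl s1 es) (gr t0 et); have [st|st] := leP (s + t) 1.
    have st0 : 0 <= s + t by lra.
    have m0 : 0 <= a + (1 - a) * (s + t).
      by rewrite addr_ge0 ?mulr_ge0 // ltW.
    have m1 : a + (1 - a) * (s + t) <= 1.
      have := ler_wpM2l (ltW a1_gt0) st; lra.
    rewrite (@gl _ (a + (1 - a) * (s + t))) //; last by rewrite es et; ring.
    have h := f_le_step m0 m1; rewrite -/g (gr st0 erefl) in h.
    have := ler_wpM2l (ltW q_gt0) h.
    have := ler_wpM2l (ltW (mulr_gt0 q_gt0 q1_gt0)) (lex_sub lf s0 t0 st); lra.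
  have m0 : 0 <= a * (s + t - 1) by rewrite mulr_ge0; lra.
  have st1 : s + t - 1 <= 1 by lra.
  have m1 : a * (s + t - 1) <= 1 by have := ler_wpM2l (ltW a_gt0) st1; lra.
  rewrite (@gr _ (a * (s + t - 1))) //; last by rewrite es et; ring.
  have h := f_le_step m0 m1; rewrite -/g (gl st1 erefl) in h.
  have := ler_wpM2l (ltW q1_gt0) h.
  have := lex_sup lf s1 t1 (ltW st).
  by move/(ler_wpM2l (ltW (mulr_gt0 q_gt0 q1_gt0))); lra.
- have st : s <= t by apply: (le_of_mul a_gt0); lra.
  rewrite (gl s1 es) (gl t1 et) (@gl _ ((1 - a) * s + a * t)).
  + have := ler_wpM2l (ltW q_gt0) (tf _ _ s0 st t1); lra.
  + have := ler_wpM2l (ltW a1_gt0) s1; have := ler_wpM2l (ltW a_gt0) t1; lra.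
  + by rewrite es et; ring.
Qed.

End Step.
End LexProfile.

(** * The odds map and the product bound *)

Section OddsRatio.
Variables (R : realFieldType) (a q : R).
Hypotheses (a_gt0 : 0 < a) (lt_aq : a < q) (q_lt : 2 * q < 1).

Let den (x : R) : R := a * (1 - q) + (q - a) * x.

(* The Moebius map multiplying the odds [x / (1 - x)] by the ratio of the odds
   of [q] and [a]. *)
Definition odds_map (x : R) : R := q * (1 - a) * x / (a * (1 - q) + (q - a) * x).

Let M_gt0 : 0 < a * (1 - q).
Proof. by apply: mulr_gt0 => //; move: a_gt0 lt_aq q_lt; lra. Qed.

Let N_gt0 : 0 < q * (1 - a).
Proof. by apply: mulr_gt0; move: a_gt0 lt_aq q_lt; lra. Qed.

Let den_gt0 x : 0 <= x -> 0 < den x.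
Proof.
by move=> x0; rewrite ltr_pwDl // mulr_ge0 //; move: a_gt0 lt_aq q_lt; lra.
Qed.

Let den_le x y : x <= y -> den x <= den y.
Proof.
by move=> xy; rewrite lerD2l ler_wpM2l //; move: a_gt0 lt_aq q_lt; lra.
Qed.

Let odds_mapC x : 0 <= x -> 1 - odds_map x = a * (1 - q) * (1 - x) / den x.
Proof.
move=> x0; have := den_gt0 x0; rewrite /odds_map /den => d0.
by field; apply: lt0r_neq0.
Qed.

Let frac_le (c x y : R) : 0 <= c -> 0 <= x -> x <= y -> c / den y <= c / den x.
Proof.
move=> c0 x0 xy; rewrite ler_wpM2l // lef_pV2 ?posrE ?den_gt0 ?den_le //.
exact: le_trans xy.
Qed.

(** On [0, 1], [den] ranges between [a * (1 - q)] and [q * (1 - a)], so the ratio of two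
    denominators never exceeds the odds ratio gained. *)
Let odds_frac u v x y : 0 <= x -> x <= 1 -> 0 <= y -> y <= 1 -> 0 <= u ->
  (1 - a) * v = a * u -> (1 - q) * v / den x <= q * u / den y.
Proof.
move: (a_gt0) (lt_aq) (q_lt) => a0 aq q2.
move=> x0 x1 y0 y1 u0 e.
rewrite ler_pdivrMr ?den_gt0 // mulrAC ler_pdivlMr ?den_gt0 //.
rewrite -(@ler_pM2l _ (1 - a)); last by lra.
have -> : (1 - a) * ((1 - q) * v * den y) = u * (a * (1 - q)) * den y.
  by transitivity ((1 - a) * v * ((1 - q) * den y)); [|rewrite e]; ring.
have -> : (1 - a) * (q * u * den x) = u * (q * (1 - a)) * den x by ring.
rewrite -!mulrA ler_wpM2l // !mulrA.
rewrite [leLHS]mulrC ler_pM ?(ltW M_gt0) ?(ltW (den_gt0 _)) //.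
  by rewrite (_ : q * (1 - a) = den 1) ?den_le // /den; ring.
by rewrite (_ : a * (1 - q) = den 0) ?den_le // /den; ring.
Qed.

Lemma odds_map0 : odds_map 0 = 0.
Proof. by rewrite /odds_map mulr0 mul0r. Qed.

Lemma odds_map1 : odds_map 1 = 1.
Proof.
rewrite /odds_map (_ : a * (1 - q) + (q - a) * 1 = q * (1 - a)); last by ring.
by rewrite mulr1 divff // lt0r_neq0.
Qed.

Lemma odds_map_ge x : 0 <= x -> x <= 1 -> x <= odds_map x.
Proof.
move=> x0 x1; rewrite ler_pdivlMr ?den_gt0 // mulrC ler_wpM2r //.
by rewrite (_ : q * (1 - a) = den 1) ?den_le // /den; ring.
Qed.

(** Since [den] is nondecreasing, splitting the numerator over a common denominator gives both
    additivity properties; [odds_frac] gives the other two. *)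
Lemma odds_map_profile : lex_profile a q odds_map.
Proof.
move: (a_gt0) (lt_aq) (q_lt) => a0 aq q2.
have N0 := ltW N_gt0; have M0 := ltW M_gt0.
split; [exact: odds_map0|exact: odds_map1| | | | ].
- move=> x y x0 y0 _; rewrite /odds_map.
  rewrite (_ : q * (1 - a) * (x + y) / (a * (1 - q) + (q - a) * (x + y)) =
    q * (1 - a) * x / den (x + y) + q * (1 - a) * y / den (x + y)); last first.
    by rewrite /den; ring.
  by apply: lerD; apply: frac_le; rewrite ?mulr_ge0 //; lra.
- move=> x y x1 y1 xy.
  have [x0 y0] : 0 <= x /\ 0 <= y by lra.
  suff : (1 - odds_map x) + (1 - odds_map y) <= 1 - odds_map (x + y - 1) by lra.
  rewrite !odds_mapC //; last by lra.
  rewrite (_ : a * (1 - q) * (1 - (x + y - 1)) / den (x + y - 1) =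
    a * (1 - q) * (1 - x) / den (x + y - 1) +
    a * (1 - q) * (1 - y) / den (x + y - 1)); last by rewrite /den; ring.
  by apply: lerD; apply: frac_le; rewrite ?mulr_ge0 //; lra.
- move=> u v u0 u1 e.
  have v0 : 0 <= v by rewrite -(@ler_pM2l _ (1 - a)) ?e ?mulr0 ?mulr_ge0 //; lra.
  have v1 : v <= 1.
    rewrite -(@ler_pM2l _ (1 - a)) ?e; last by lra.
    by have := ler_wpM2l (ltW a0) u1; lra.
  have := ler_wpM2l N0 (odds_frac v0 v1 u0 u1 u0 e).
  by rewrite /odds_map /den; congr (_ <= _); ring.
- move=> u v u0 u1 e.
  have v0 : 0 <= v by rewrite -(@ler_pM2l _ (1 - a)) ?e ?mulr0 ?mulr_ge0 //; lra.
  have v1 : v <= 1.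
    rewrite -(@ler_pM2l _ (1 - a)) ?e; last by lra.
    by have := ler_wpM2l (ltW a0) u1; lra.
  rewrite !odds_mapC; [|lra|lra].
  have h : (1 - q) * v / den (1 - v) <= q * u / den (1 - u).
    by apply: odds_frac => //; lra.
  have := ler_wpM2l M0 h; congr (_ <= _); ring.
Qed.

Lemma odds_map_two_point : two_point a q odds_map.
Proof.
move: (a_gt0) (lt_aq) (q_lt) => a0 aq q2 x y x0 xy y1.
have y0 := le_trans x0 xy.
have m0 : 0 <= (1 - a) * x + a * y by rewrite addr_ge0 ?mulr_ge0 //; lra.
have form z : 0 <= z ->
    odds_map z = q * (1 - a) / (q - a) * (1 - a * (1 - q) / den z).
  move=> z0; have := den_gt0 z0; rewrite /odds_map /den => d0.
  by field; rewrite !lt0r_neq0 //; lra.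
rewrite !form //.
rewrite [leRHS](_ : _ = q * (1 - a) / (q - a) *
  (1 - a * (1 - q) * ((1 - q) / den x + q / den y))); last by ring.
rewrite ler_wpM2l ?divr_ge0 ?(ltW N_gt0) //; first by lra.
rewrite lerD2l lerN2 ler_wpM2l ?(ltW M_gt0) //.
have -> : den ((1 - a) * x + a * y) = (1 - a) * den x + a * den y.
  by rewrite /den; ring.
have X0 := den_gt0 x0; have Y0 := den_gt0 y0.
have XM : a * (1 - q) <= den x by rewrite lerDl mulr_ge0 //; lra.
have YN : den y <= q * (1 - a).
  by rewrite (_ : q * (1 - a) = den 1) ?den_le // /den; ring.
have XY := den_le xy.
move: (den x) (den y) X0 Y0 XM YN XY => X Y X0 Y0 XM YN XY.
have -> : (1 - q) / X + q / Y = ((1 - q) * Y + q * X) / (X * Y).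
  by field; rewrite !lt0r_neq0.
have D0 : 0 < (1 - a) * X + a * Y by rewrite addr_gt0 ?mulr_gt0 //; lra.
rewrite ler_pdivrMr ?mulr_gt0 // [leRHS]mulrC ler_pdivlMr //.
have NM : 0 <= q * (1 - a) * X - a * (1 - q) * Y.
  by rewrite subr_ge0 [leRHS]mulrC ler_pM ?(ltW M_gt0) ?(ltW Y0).
have D : 0 <= Y - X by lra.
(* After clearing denominators the gap is exactly this product. *)
have := mulr_ge0 D NM; lra.
Qed.

(** This starts the monotone iteration: by [lex_step_le] all iterates then satisfy
    [f <= lex_step f], which the stability lemmas require. *)
Lemma odds_map_le_step x : 0 <= x -> x <= 1 ->
  odds_map x <= lex_step a q odds_map x.
Proof.
move: (a_gt0) (lt_aq) (q_lt) => a0 aq q2 x0 x1.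
case: (lex_cases a_gt0 lt_aq q_lt x0 x1) => -[t [t0 t1 e]].
  rewrite (lex_stepl a_gt0 lt_aq q_lt _ t1 e) e /odds_map.
  have at0 : 0 <= a * t by rewrite mulr_ge0 // ltW.
  have dt := den_gt0 t0; have dat := den_gt0 at0.
  rewrite ler_pdivrMr // [leRHS](_ : _ =
    q * (q * (1 - a) * t) * den (a * t) / den t); last by rewrite /den; ring.
  rewrite ler_pdivlMr //.
  have -> : q * (1 - a) * (a * t) * den t = q * (1 - a) * t * (a * den t) by ring.
  rewrite [leRHS](_ : _ = q * (1 - a) * t * (q * den (a * t))); last first.
    by rewrite /den; ring.
  rewrite ler_wpM2l ?(mulr_ge0 (ltW N_gt0)) // /den.
  have u0 : 0 <= 1 - t by lra.
  have w0 : 0 < (1 - q) * (q - a) by rewrite mulr_gt0 //; lra.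
  have := mulr_ge0 (ltW (mulr_gt0 a0 w0)) u0; lra.
rewrite (lex_stepr a_gt0 lt_aq q_lt odds_map0 odds_map1 t0 e).
suff : (1 - q) * (1 - odds_map t) <= 1 - odds_map x by lra.
rewrite !odds_mapC // e.
have t0' : 0 <= (1 - a) * t by rewrite mulr_ge0 //; lra.
have dt := den_gt0 t0; have dx : 0 < den (a + (1 - a) * t) by apply: den_gt0; lra.
rewrite [leLHS](_ : _ = (1 - q) * (a * (1 - q) * (1 - t)) / den t); last first.
  by rewrite /den; ring.
rewrite ler_pdivrMr // [leRHS]mulrAC ler_pdivlMr //.
have -> : (1 - q) * (a * (1 - q) * (1 - t)) * den (a + (1 - a) * t) =
  (a * (1 - q) * (1 - t)) * ((1 - q) * den (a + (1 - a) * t)) by ring.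
have -> : a * (1 - q) * (1 - (a + (1 - a) * t)) * den t =
  (a * (1 - q) * (1 - t)) * ((1 - a) * den t) by ring.
have t1' : 0 <= 1 - t by lra.
rewrite ler_wpM2l ?(mulr_ge0 (ltW M_gt0)) // /den.
have w0 : 0 < q * (q - a) by rewrite mulr_gt0 //; lra.
have := mulr_ge0 (ltW w0) t0'; lra.
Qed.

(** * Iterates of the self-similarity and the product bound *)

Definition lex_fun (m : nat) : R -> R := iter m (lex_step a q) odds_map.

Lemma lex_fun_profile m : lex_profile a q (lex_fun m) /\
  forall x, 0 <= x -> x <= 1 -> lex_fun m x <= lex_fun m.+1 x.
Proof.
elim: m => [|m [IHp IHle]].
  by split; [exact: odds_map_profile|exact: odds_map_le_step].
have IH' := lex_profile_step a_gt0 lt_aq q_lt IHp IHle.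
split=> // x x0 x1; rewrite /lex_fun /= in IHp IHle IH' *.
by apply: (lex_step_le a_gt0 lt_aq q_lt IHle) => //;
  [exact: (lex_0 IHp)|exact: (lex_1 IHp)|exact: (lex_0 IH')|exact: (lex_1 IH')].
Qed.

Lemma lex_fun_two_point m : two_point a q (lex_fun m).
Proof.
elim: m => [|m IHm]; first exact: odds_map_two_point.
by have [p le] := lex_fun_profile m; apply: (two_point_step a_gt0 lt_aq q_lt p le).
Qed.

Lemma lex_fun_scale j m t : 0 <= t -> t <= 1 ->
  lex_fun (j + m) (a ^+ j * t) = q ^+ j * lex_fun m t.
Proof.
move: (a_gt0) (lt_aq) (q_lt) => a0 aq q2 t0 t1.
elim: j => [|j IHj]; first by rewrite !mul1r.
rewrite addSn exprS -mulrA [lex_fun _.+1 _]/=.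
rewrite (@lex_stepl _ a q a_gt0 lt_aq q_lt _ _ (a ^+ j * t)) //.
  by rewrite -/(lex_fun _) IHj exprS mulrA.
rewrite mulr_ile1 // ?exprn_ge0 ?exprn_ile1 //; lra.
Qed.

(* In [v] the left-hand side minus [1] is, up to a positive factor, a quadratic
   that is nonpositive at [0] and [1]. It is convex unless
   [(1 + X) * (1 - Y) <= (1 + a * X) * (1 - q * Y)], and then its Bernstein
   coefficients on [0, 1] are nonpositive. *)
Lemma odds_map_hyperbola X Y v : 0 <= X -> 0 <= Y -> 0 <= v -> v <= 1 ->
  (1 + X) * (1 - Y) <= 1 -> (1 + a * X) * (1 - q * Y) <= 1 ->
  (1 + a * X + (1 - a) * X * v) * (1 - q * Y - (1 - q) * Y * odds_map v) <= 1.
Proof.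
move: (a_gt0) (lt_aq) (q_lt) => a0 aq q2 X0 Y0 v0 v1 s0 s1.
have d0 := den_gt0 v0; have M0 := ltW M_gt0; have N0 := ltW N_gt0.
have u0 : 0 <= 1 - v by lra.
set M := a * (1 - q) in M0 *; set N := q * (1 - a) in N0 *.
set C := 1 + a * X in s1 *; set E := 1 + X in s0 *.
have -> : 1 - q * Y - (1 - q) * Y * odds_map v =
    ((1 - q * Y) * M * (1 - v) + N * (1 - Y) * v) / den v.
  have := lt0r_neq0 d0; rewrite /odds_map /den /M /N => d.
  by field.
rewrite mulrA ler_pdivrMr // mul1r.
have -> : C + (1 - a) * X * v = C * (1 - v) + E * v by rewrite /C /E; ring.
have -> : den v = M * (1 - v) + N * v by rewrite /den /M /N; ring.
have vv0 := mulr_ge0 v0 v0; have uv0 := mulr_ge0 u0 v0.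
have [ss|ss] := leP (E * (1 - Y)) (C * (1 - q * Y)).
  have mid : 0 <= (1 - a) * (1 - q) * (q * Y * C - a * X * (1 - q * Y)).
    apply: mulr_ge0; first by rewrite mulr_ge0; lra.
    have : 0 <= q * Y * (a * X) by rewrite !mulr_ge0 //; lra.
    by move: s1; rewrite /C; lra.
  have h1 : 0 <= (M * (1 - v) + N * v) * (1 - C * (1 - q * Y)).
    by rewrite mulr_ge0 ?subr_ge0 // addr_ge0 // mulr_ge0.
  have h2 : 0 <= v * v * (N * (C * (1 - q * Y) - E * (1 - Y))).
    by rewrite mulr_ge0 // mulr_ge0 // subr_ge0.
  have h3 := mulr_ge0 uv0 mid.
  rewrite -subr_ge0; have := addr_ge0 (addr_ge0 h1 h2) h3.
  by congr (0 <= _); rewrite /M /N /C /E; ring.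
(* Both factors, linear in [v] after clearing [den v], are then nondecreasing, so their product is
   convex and lies below its chord. *)
have slope : 0 <= N * (1 - Y) - (1 - q * Y) * M.
  have k : 0 < X * ((q - a) - q * Y * (1 - a)).
    have : 0 <= (1 - q) * (Y - X * (1 - Y)).
      by apply: mulr_ge0; move: s0; rewrite /E; lra.
    move: ss; rewrite /C /E; lra.
  have k' : 0 < (q - a) - q * Y * (1 - a).
    by rewrite ltNge; apply/negP => k'; have := mulr_ge0_le0 X0 k'; lra.
  have : 0 <= q * Y * M by rewrite !mulr_ge0 //; lra.
  by rewrite /M /N; lra.
have h1 : 0 <= (1 - v) * (M * (1 - C * (1 - q * Y))).
  by rewrite mulr_ge0 // mulr_ge0 // subr_ge0.
have h2 : 0 <= v * (N * (1 - E * (1 - Y))).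
  by rewrite mulr_ge0 // mulr_ge0 // subr_ge0.
have h3 : 0 <= (1 - v) * v * ((1 - a) * X * (N * (1 - Y) - (1 - q * Y) * M)).
  by apply: mulr_ge0 => //; apply: mulr_ge0 => //; apply: mulr_ge0 => //; lra.
rewrite -subr_ge0; have := addr_ge0 (addr_ge0 h1 h2) h3.
by congr (0 <= _); rewrite /M /N /C /E; ring.
Qed.

(** For [j >= 1], [z = a ^+ j] corresponds under [a + (1 - a) * z] to the measure of a family
    A_(j-1); these are the cut points of [a, 1]. *)
Lemma geometric_split n z : a ^+ n < z -> z <= 1 ->
  exists j v, [/\ 0 <= v, v <= 1 & z = a ^+ j * (a + (1 - a) * v)].
Proof.
move: (a_gt0) (lt_aq) (q_lt) => a0 aq q2.
elim: n z => [|n IHn] z; first by rewrite ltNge => /negP.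
move=> nz z1; have z0 : 0 <= z.
  by apply: le_trans (ltW nz); rewrite exprn_ge0 // ltW.
case: (lex_cases a_gt0 lt_aq q_lt z0 z1) => -[t [t0 t1 e]]; last first.
  by exists 0%N, t; rewrite mul1r.
case: (IHn t) => // [|j [v [v0 v1 et]]].
  by move: nz; rewrite e exprS ltr_pM2l.
by exists j.+1, v; rewrite exprS -mulrA -et.
Qed.

Lemma lex_fun_product x : 0 <= x -> x <= 1 ->
  (forall z, 0 < z -> exists n, a ^+ n < z) ->
  (forall j, (1 + (1 - a) * a ^+ j) * (1 - q ^+ j.+1) <= 1) ->
  exists m, x * (1 - lex_fun m x) <= a * (1 - q).
Proof.
move: (a_gt0) (lt_aq) (q_lt) => a0 aq q2 x0 x1 arch hyp.
case: (lex_cases a_gt0 lt_aq q_lt x0 x1) => -[t [t0 t1 e]].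
  (* Here [odds_map t >= t] suffices, because [t * (1 - q * t)] increases on [0, 1] when
     [2 * q < 1]. *)
  exists 1%N; rewrite /lex_fun /= (lex_stepl a_gt0 lt_aq q_lt _ t1 e) e.
  rewrite -mulrA ler_pM2l //.
  have h : t * (1 - q * odds_map t) <= t * (1 - q * t).
    by rewrite ler_wpM2l // lerD2l lerN2 ler_pM2l ?odds_map_ge //; lra.
  apply: le_trans h _.
  have w : 0 <= 1 - q * (1 + t).
    by have := ler_wpM2l (ltW (lt_trans a0 aq)) t1; lra.
  have u : 0 <= 1 - t by lra.
  have := mulr_ge0 u w; lra.
have [p0 p1] : lex_fun 0 0 = 0 /\ lex_fun 0 1 = 1.
  by split; [exact: odds_map0|exact: odds_map1].
move: t0; rewrite le_eqVlt => /predU1P[t0|t0].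
  exists 1%N; rewrite [lex_fun _ _](@lex_stepl _ _ _ a_gt0 lt_aq q_lt _ _ 1) //.
    by rewrite odds_map1 e -t0; lra.
  by rewrite e -t0; ring.
have [n hn] := arch _ t0.
have [j [v [v0 v1 et]]] := geometric_split hn t1.
have w0 : 0 <= a + (1 - a) * v by rewrite addr_ge0 ?mulr_ge0 //; lra.
have w1 : a + (1 - a) * v <= 1.
  have b0 : 0 <= 1 - a by lra.
  have := ler_wpM2l b0 v1; lra.
have [[f0 f1 _ _ _ _] _] := lex_fun_profile (j + 1).
(* One step enters the right piece, [j] steps undo the factor [a ^+ j], and one more right step
   leaves [odds_map v]. *)
exists (j + 1).+1.
rewrite [lex_fun _ _](lex_stepr a_gt0 lt_aq q_lt f0 f1 (ltW t0) e).
rewrite [in X in _ * X](et) lex_fun_scale //.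
rewrite [lex_fun 1 _](lex_stepr a_gt0 lt_aq q_lt p0 p1 v0 erefl).
rewrite /lex_fun [iter 0 _ _]/=.
(* The ends [v = 0] and [v = 1] of the piece are governed by the hypothesis at [j] and at [j - 1];
   for [j = 0] the factor [1 - Y] vanishes. *)
pose X := (1 - a) / a * a ^+ j; pose Y := q ^+ j.
have X0 : 0 <= X by rewrite mulr_ge0 ?divr_ge0 ?exprn_ge0 //; lra.
have Y0 : 0 <= Y by rewrite exprn_ge0 //; lra.
have aX : a * X = (1 - a) * a ^+ j by rewrite /X; field; exact: lt0r_neq0.
have s1 : (1 + a * X) * (1 - q * Y) <= 1 by rewrite aX -exprS.
have s0 : (1 + X) * (1 - Y) <= 1.
  rewrite /X /Y; case: (j) => [|i]; first by rewrite subrr mulr0.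
  rewrite (_ : _ / _ * _ = (1 - a) * a ^+ i) // exprS.
  by field; exact: lt0r_neq0.
have := odds_map_hyperbola X0 Y0 v0 v1 s0 s1.
have aq0 : 0 <= a * (1 - q) by exact: ltW M_gt0.
have xE : x = a * (1 + a * X + (1 - a) * X * v).
  by rewrite e et mulrA -aX; ring.
by move/(ler_wpM2l aq0); rewrite mulr1 xE -/Y; congr (_ <= _); ring.
Qed.

End OddsRatio.

(** * Biased measures of families *)

Section BiasedMean.
Variables (R : realFieldType) (T : finType).
Implicit Types (p : R) (r : seq T) (f : {set T} -> R) (A B : {set T}).

(** The product measure is built one coordinate at a time, in an order chosen through [r], so that
    inequalities can be proved by induction on [r]. *)
Fixpoint biased_mean p r f A : R :=
  if r is i :: r' then
    (1 - p) * biased_mean p r' f A + p * biased_mean p r' f (i |: A)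
  else f A.

Lemma biased_mean_le p r f A B : 0 <= p -> p <= 1 ->
  (forall A B, A \subset B -> f A <= f B) ->
  A \subset B -> biased_mean p r f A <= biased_mean p r f B.
Proof.
move=> p0 p1 fm; elim: r A B => [|i r IHr] A B AB /=; first exact: fm.
by rewrite lerD // ler_wpM2l ?subr_ge0 // IHr // setUS.
Qed.

Lemma biased_mean_const p r f A :
  (forall i B, i \in r -> f (i |: B) = f B) -> biased_mean p r f A = f A.
Proof.
elim: r A => //= i r IHr A fr.
have fr' j B : j \in r -> f (j |: B) = f B.
  by move=> jr; apply: fr; rewrite inE jr orbT.
by rewrite !IHr // fr ?mem_head //; ring.
Qed.

Lemma biased_mean_itv p r f A : 0 <= p -> p <= 1 -> (forall A, 0 <= f A <= 1) ->
  0 <= biased_mean p r f A <= 1.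
Proof.
move=> p0 p1 f01; elim: r A => [|i r IHr] A //=.
have /andP[a0 a1] := IHr A; have /andP[b0 b1] := IHr (i |: A).
have q0 : 0 <= 1 - p by lra.
rewrite addr_ge0 ?mulr_ge0 //=.
have := ler_wpM2l q0 a1; have := ler_wpM2l p0 b1; lra.
Qed.

(** Monotonicity of [P] orders the means of the two sections, as [two_point] demands; at the leaves
    the indicator is 0 or 1, where [k] is the identity. *)
Lemma biased_mean_two_point p q k r (P : pred {set T}) A :
  0 <= p -> p <= 1 -> 0 <= q -> q <= 1 ->
  two_point p q k -> k 0 = 0 -> k 1 = 1 ->
  (forall A B, A \subset B -> P A -> P B) ->
  k (biased_mean p r (fun A => (P A)%:R) A) <=
  biased_mean q r (fun A => (P A)%:R) A.
Proof.
move=> p0 p1 q0 q1 tk k0 k1 Pm.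
have f01 B : 0 <= ((P B)%:R : R) <= 1 by case: (P B); rewrite ?lexx ler01.
elim: r A => [|i r IHr] A /=; first by case: (P A); rewrite ?k0 ?k1.
have /andP[a0 _] := biased_mean_itv r A p0 p1 f01.
have /andP[_ b1] := biased_mean_itv r (i |: A) p0 p1 f01.
apply: le_trans (tk _ _ a0 _ b1) _.
  apply: biased_mean_le => //; last exact: subsetUr.
  by move=> B C /Pm PBC; rewrite ler_nat; case: (P B) PBC => // ->.
by rewrite lerD // ler_wpM2l ?subr_ge0.
Qed.

Lemma biased_mean_sum p r f A : uniq r ->
  biased_mean p r f A =
  \sum_(B : {set T} | B \subset r)
    p ^+ #|B| * (1 - p) ^+ (size r - #|B|) * f (B :|: A).
Proof.
elim: r A => [|i r IHr] A /=.
  move=> _; rewrite (big_pred1 set0) => [|B].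
    by rewrite cards0 !mul1r set0U.
  by rewrite /= -subset0; apply: eq_subset_r => x; rewrite inE.
case/andP=> ir ur; rewrite !IHr //.
rewrite [RHS](bigID (fun B : {set T} => i \in B)) /= [RHS]addrC.
congr (_ + _).
  rewrite mulr_sumr; apply: eq_big => [B|B Br].
    apply/idP/andP => [Br|[/subsetP Br iB]].
      split.
        apply: subset_trans Br _; apply/subsetP => x.
        by rewrite inE orbC => ->.
      by apply: contra ir => /(subsetP Br).
    apply/subsetP => x xB; have := Br x xB; rewrite inE => /predU1P[xi|//].
    by rewrite -xi xB in iB.
  have Bs : (#|B| <= size r)%N.
    by apply: leq_trans (subset_leq_card Br) (card_size r).
  by rewrite subSn // exprS; ring.
rewrite mulr_sumr.
rewrite [RHS](reindex_onto (fun B => i |: B) (fun B => B :\ i)) /=; last first.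
  by move=> B /andP[_ iB]; rewrite setD1K.
apply: eq_big => [B|B Br].
  rewrite setU11 andbT; apply/idP/andP => [Br|[/subsetP Br /eqP BE]].
    have iB : i \notin B by apply: contra ir => /(subsetP Br).
    split; last by rewrite setU1K.
    apply/subsetP => x; rewrite !inE => /predU1P[->|/(subsetP Br) ->].
      by rewrite eqxx.
    by rewrite orbT.
  have iB : i \notin B by rewrite -BE setD11.
  apply/subsetP => x xB; have := Br x (setU1r _ xB).
  rewrite inE => /predU1P[xi|//].
  by rewrite -xi xB in iB.
have iB : i \notin B by apply: contra ir => /(subsetP Br).
by rewrite cardsU1 iB add1n subSS exprS setUCA setUA; ring.
Qed.

End BiasedMean.

(** * Measures of families, complements and up-closures *)

Section Mu.
Variables (R : realType) (n : nat).
Implicit Types (p : R) (F G U : {set {set 'I_n}}).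

Lemma mu_biased_mean p F r : uniq r -> (forall i, i \in r) ->
  mu p F = biased_mean p r (fun A => (A \in F)%:R) set0.
Proof.
move=> ur rT; have rs : size r = n.
  by rewrite -(card_uniqP ur) -[RHS]card_ord; apply: eq_card => i; rewrite rT.
rewrite biased_mean_sum // rs /mu [LHS]big_mkcond; apply: eq_big => B /=.
  by symmetry; apply/subsetP.
by rewrite setU0; case: (B \in F); rewrite ?mulr1 ?mulr0.
Qed.

Lemma mu_le p F G : 0 <= p -> p <= 1 -> F \subset G -> mu p F <= mu p G.
Proof.
move=> p0 p1 FG; rewrite /mu [leRHS](big_setID F) /= (setIidPr FG) lerDl.
by apply: sumr_ge0 => B _; rewrite mulr_ge0 ?exprn_ge0 // subr_ge0.
Qed.

Lemma mu_ge0 p F : 0 <= p -> p <= 1 -> 0 <= mu p F.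
Proof.
by move=> p0 p1; apply: sumr_ge0 => B _; rewrite mulr_ge0 ?exprn_ge0 // subr_ge0.
Qed.

Lemma mu_setT p : mu p [set: {set 'I_n}] = 1.
Proof.
rewrite (@mu_biased_mean _ _ (enum 'I_n)) ?enum_uniq // => [|i]; last first.
  by rewrite mem_enum.
by rewrite biased_mean_const ?inE // => i B _; rewrite !inE.
Qed.

Lemma mu_setC p F : mu p (~: F) = 1 - mu p F.
Proof.
rewrite -(mu_setT p) /mu [in RHS](big_setID F) /= setTI setTD.
by rewrite addrAC subrr add0r.
Qed.

Lemma mu_compl p F : mu p [set ~: A | A in F] = mu (1 - p) F.
Proof.
rewrite /mu big_imset /=; last by move=> A B _ _; apply: setC_inj.
apply: eq_bigr => A _; have := cardsC A; rewrite card_ord => e.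
rewrite -[X in (X - _)%N]e -[X in (X - #|A|)%N]e addnK addKn.
by rewrite opprB addrCA subrr addr0 mulrC.
Qed.

Lemma mu_star p (i : 'I_n) : mu p [set A : {set 'I_n} | i \in A] = p.
Proof.
(* With [i] enumerated first, the indicator is constant in all later coordinates. *)
rewrite (@mu_biased_mean _ _ (i :: rem i (enum 'I_n))); last 2 first.
- by rewrite /= rem_uniq ?enum_uniq // mem_rem_uniq ?enum_uniq // !inE eqxx.
- by move=> j; rewrite inE mem_rem_uniq ?enum_uniq // !inE mem_enum andbT orbN.
have h j (B : {set 'I_n}) : j \in rem i (enum 'I_n) ->
    ((j |: B) \in [set A : {set 'I_n} | i \in A])%:R =
    (B \in [set A : {set 'I_n} | i \in A])%:R :> R.
  rewrite mem_rem_uniq ?enum_uniq // !inE => /andP[/negPf ji _].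
  by rewrite eq_sym ji.
rewrite /= !(biased_mean_const _ _ h) !inE eqxx /=; ring.
Qed.

Definition up_closure F : {set {set 'I_n}} :=
  [set A : {set 'I_n} | [exists B : {set 'I_n}, (B \in F) && (B \subset A)]].

Lemma up_closure_sub F : F \subset up_closure F.
Proof.
by apply/subsetP => A AF; rewrite inE; apply/existsP; exists A; rewrite AF subxx.
Qed.

Lemma up_closure_up F (A B : {set 'I_n}) :
  A \subset B -> A \in up_closure F -> B \in up_closure F.
Proof.
rewrite !inE => AB /existsP[C /andP[CF CA]]; apply/existsP; exists C.
by rewrite CF (fintype.subset_trans CA AB).
Qed.

Lemma mu_cross_intersecting p F G : 0 <= p -> p <= 1 -> cross_intersecting F G ->
  mu p G <= 1 - mu (1 - p) (up_closure F).
Proof.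
move=> p0 p1 FG; rewrite -mu_setC.
have -> : mu p G = mu (1 - p) [set ~: B | B in G] by rewrite mu_compl subKr.
apply: mu_le; rewrite ?subr_ge0 ?gerBl //.
apply/subsetP => _ /imsetP[B BG ->]; rewrite !inE.
apply/existsP => -[A /andP[AF AB]].
by have := FG _ _ AF BG; rewrite setI_eq0 disjoints_subset AB.
Qed.

End Mu.

(** Comparison with powers of 1/2 reduces this to the Archimedean property. *)
Lemma exprn_small (R : realType) (a z : R) : 0 <= a -> 2 * a < 1 -> 0 < z ->
  exists n, a ^+ n < z.
Proof.
move=> a0 a2 z0; have [n hn] : exists n, z^-1 < 2 ^+ n.
  by exists (Num.bound z^-1); apply: upper_nthrootP.
have p2 : 0 < 2 ^+ n :> R by rewrite exprn_gt0.
exists n; apply: (@le_lt_trans _ _ (2 ^+ n)^-1).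
  rewrite -[leRHS]mul1r ler_pdivlMr // -exprMn; apply: exprn_ile1; lra.
by rewrite -[ltRHS]invrK ltf_pV2 // posrE invr_gt0.
Qed.

(** * The maximum product of measures *)

Local Open Scope classical_set_scope.
Local Open Scope ring_scope.

Theorem theorem1 (R : realType) (alpha beta : R)
  (halpha : 0 < alpha) (hbeta : 1 / 2 < beta) (hsum : alpha + beta < 1)
  (hAB : forall j : nat,
    (alpha + (1 - alpha) * alpha ^+ j.+1) *
      (beta - beta * (1 - beta) ^+ j.+1) < alpha * beta)
  (n : nat) (hn : (1 <= n)%N) :
  is_max [set x : R | exists F G : {set {set 'I_n}},
            cross_intersecting F G /\ x = mu alpha F * mu beta G]
         (alpha * beta).
Proof.
split.
  (* The star of one element, taken twice, attains the value. *)
  pose i := Ordinal hn; pose S := [set A : {set 'I_n} | i \in A]%SET.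
  exists S, S; split; last by rewrite !mu_star.
  move=> A B; rewrite !inE => iA iB; apply/set0Pn; exists i.
  by rewrite inE iA.
move=> _ [F [G [FG ->]]].
pose q := 1 - beta; pose U := up_closure F.
have b2 : 1 < 2 * beta by lra.
have lt_aq : alpha < q by rewrite /q; lra.
have q2 : 2 * q < 1 by rewrite /q; lra.
have [a0 a1] : 0 <= alpha /\ alpha <= 1 by lra.
have [b0 b1] : 0 <= beta /\ beta <= 1 by lra.
have [q0 q1] : 0 <= q /\ q <= 1 by rewrite /q; lra.
(* This is the assumption on A_j and B_j divided by [alpha * beta]. *)
have hyp j : (1 + (1 - alpha) * alpha ^+ j) * (1 - q ^+ j.+1) <= 1.
  have ab0 : 0 < alpha * beta by rewrite mulr_gt0 //; lra.
  rewrite -(ler_pM2l ab0) mulr1; apply: le_trans (ltW (hAB j)).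
  by rewrite -/q !exprS le_eqVlt; apply/orP; left; apply/eqP; ring.
have enT (i : 'I_n) : i \in enum 'I_n by rewrite mem_enum.
have muU p := mu_biased_mean p U (enum_uniq 'I_n) enT.
have /andP[x0 x1] : 0 <= mu alpha U <= 1.
  rewrite muU; apply: biased_mean_itv => // A.
  by case: (A \in U); rewrite ?lexx ?ler01.
have arch z : 0 < z -> exists n, alpha ^+ n < z.
  by apply: exprn_small => //; lra.
have [m hm] := lex_fun_product halpha lt_aq q2 x0 x1 arch hyp.
have [[f0 f1 _ _ _ _] _] := lex_fun_profile halpha lt_aq q2 m.
have lexU : lex_fun alpha q m (mu alpha U) <= mu q U.
  rewrite !muU; apply: biased_mean_two_point => //.
    exact: lex_fun_two_point.
  by move=> A B; apply: up_closure_up.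
have hG : mu beta G <= 1 - mu q U by apply: mu_cross_intersecting.
have hF : mu alpha F <= mu alpha U by apply: mu_le => //; apply: up_closure_sub.
have -> : alpha * beta = alpha * (1 - q) by rewrite /q; ring.
apply: le_trans hm; apply: ler_pM; rewrite ?mu_ge0 //.
by apply: le_trans hG _; rewrite lerD2l lerN2.
Qed.
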